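(* Let $d\geq 2$ be an integer and let $k=1$ or $k=d-1$. Then there is a constant $C$ (which may depend on $d$ and $k$, but is independent of $q=|\mathbb F_q|$ and of $f$) such that for every finite field $\mathbb F_q$ and every function $f:\mathbb F_q^d\to\mathbb C$, $$ \|T_{\Pi_k}f\|_{L^{d+1}(\Pi_k,d\sigma)} \leq C\, \|f\|_{L^{\frac{d+1}{k+1}}(\mathbb F_q^d,dx)}.$$
   Context: $\mathbb F_q$ is the finite field with $q$ elements. For $1\le k\le d-1$, $\Pi_k$ denotes the collection of all $k$-planes in $\mathbb F_q^d$, i.e. all $k$-dimensional affine subspaces of $\mathbb F_q^d$ (not necessarily through the origin). For $f:\mathbb F_q^d\to\mathbb C$ and $w\in\Pi_k$, the $k$-plane transform is $$T_{\Pi_k}f(w)=\frac{1}{|w|}\sum_{x\in w} f(x),$$ where $|w|=q^k$ is the number of points of $w$. ($T_{\Pi_1}$ is the $X$-ray transform and $T_{\Pi_{d-1}}$ is the Radon transform.) $dx$ is the normalized counting measure on $\mathbb F_q^d$ and $d\sigma$ is the normalized counting measure on $\Pi_k$, so that for $1\le p,r<\infty$ $$\|f\|_{L^p(\mathbb F_q^d,dx)}=\Big(\frac{1}{q^d}\sum_{x\in\mathbb F_q^d}|f(x)|^p\Big)^{1/p},\qquad \|\Omega\|_{L^r(\Pi_k,d\sigma)}=\Big(\frac{1}{|\Pi_k|}\sum_{w\in\Pi_k}|\Omega(w)|^r\Big)^{1/r},$$ where $|\Pi_k|$ denotes the cardinality of $\Pi_k$. *)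

(* Defs.v *)
From mathcomp Require Import all_boot all_order all_algebra.
From mathcomp Require Import complex.
From mathcomp Require Import boolp reals exp.

Set Implicit Arguments.
Unset Strict Implicit.
Unset Printing Implicit Defensive.

Import Order.TTheory GRing.Theory Num.Theory.

Local Open Scope ring_scope.
Local Open Scope complex_scope.

(* A plane need not pass through the origin: it is a coset v + U with
   \dim U = k. *)
Definition kplanes (F : finFieldType) (d k : nat) : {set {set 'rV[F]_d}} :=
  [set w : {set 'rV[F]_d} |
    `[< exists (v : 'rV[F]_d) (U : {vspace 'rV[F]_d}),
          \dim U = k /\ w = [set x | x - v \in U] >]].

(* Meaningful for nonempty w; it is only evaluated at planes. *)
Definition plane_transform (R : realType) (F : finFieldType) (d : nat)
    (f : 'rV[F]_d -> R[i]) (w : {set 'rV[F]_d}) : R[i] :=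
  #|w|%:R^-1 * \sum_(x in w) f x.

(* L^p norm with respect to the normalized counting measure on A;
   Normc.normc is the complex modulus with values in R rather than R[i]. *)
Definition avg_Lnorm (R : realType) (T : finType) (A : {set T})
    (p : R) (g : T -> R[i]) : R :=
  (#|A|%:R^-1 * \sum_(x in A) Normc.normc (g x) `^ p) `^ p^-1.

(* Main.v *)
Require Import Defs.
From mathcomp Require Import all_boot all_order all_algebra.
From mathcomp Require Import complex.
From mathcomp Require Import boolp reals exp.
From mathcomp Require Import finfield ring lra zify.

Import Order.TTheory GRing.Theory Num.Theory.

Local Open Scope ring_scope.
Local Open Scope complex_scope.

(** Write [q = #|F|], [n = q ^ d] for the number of points, [K = q ^ k] for the
number of points of a [k]-plane, and [S] for the sum of [h ^ (d + 1)], where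
[h] is the [(k + 1)]-st root of [|f|]. The substitution [|f| = h ^ (k + 1)]
removes all fractional exponents: after the normalisations are cleared, the
estimate becomes

  [sum_w (sum_(x in w) h x ^ (k + 1)) ^ (d + 1) <= C * N1 * S ^ (k + 1)],

where [N1] is the number of [k]-planes through a point.

The only geometry that enters is that the [k]-planes form a 2-design: the
affine group acts on them and is doubly transitive on points, so the number
[N1] of planes through a point and the number [N2] of planes through two
distinct points are constant. Double counting gives [N1 / N = K / n], where
[N] is the number of planes, and [N2 <= N1 * K / n]. Thus two points lie on a
common plane no more often than if the incidences were independent.

X-ray transform ([k = 1]). A line sum of [h ^ 2] is either dominated by its
largest term, or by the sum of the other terms. In the first case its
[(d + 1)]-st power is bounded by diagonal terms [h x ^ (2 * (d + 1))]; in the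
second the power mean inequality bounds it by off-diagonal products
[h x ^ (d + 1) * h y ^ (d + 1)] (lemma [sqr_sum_diag_offdiag]). Summing over
the lines, the diagonal is counted [N1] times and the off-diagonal only [N2]
times, which compensates the power of [q] lost in the power mean inequality.

Radon transform ([k = d - 1]). This is real interpolation between the trivial
[L^1 -> L^oo] bound and an [L^2] bound with a gain. By the 2-design property,
the plane sums of a function [g] deviate from their average with a sum of
squares of at most [N1 * sum g ^ 2] ([two_design_variance_le]). Planes on
which the sum of [|f|] is at most four times the average are handled by the
power mean inequality. For the other planes, the values of the plane sum are
cut into dyadic levels. At the level [mu], the values of [|f|] with
[h x * mu > 8 * S] have a total of at most [mu / 8], so they can be discarded,
and the truncated function still deviates from its average by at least half
of the plane sum ([large_plane_sum_le]). Applying the variance bound on each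
level and summing the resulting geometric series for each point gives the
claim ([truncation_levels_le]). *)

(** * Power sums *)

Section PowerSums.
Set Implicit Arguments.
Unset Strict Implicit.
Variables (R : realFieldType) (T : finType) (A : {set T}) (b : T -> R).
Hypothesis b_ge0 : forall x, 0 <= b x.

Let M a := \sum_(x in A) b x ^+ a.

Let M_ge0 a : 0 <= M a.
Proof. by apply: sumr_ge0 => x _; rewrite exprn_ge0. Qed.

(** The difference of the two sides is half of the double sum of the
nonnegative terms [(b x * b y) ^ a * (b x - b y) ^ 2]. *)
Lemma power_sum_log_convex a : M a.+1 ^+ 2 <= M a * M a.+2.
Proof.
have H : 0 <= \sum_(x in A) \sum_(y in A) (b x * b y) ^+ a * (b x - b y) ^+ 2.
  apply: sumr_ge0 => x _; apply: sumr_ge0 => y _.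
  by rewrite mulr_ge0 ?sqr_ge0// exprn_ge0 ?mulr_ge0.
suff E : \sum_(x in A) \sum_(y in A) (b x * b y) ^+ a * (b x - b y) ^+ 2
    = M a.+2 * M a + M a * M a.+2 - 2 * (M a.+1 * M a.+1).
  by move: H; rewrite E => H; nra.
rewrite /M !mulr_suml mulr_sumr -big_split /= -sumrB.
apply: eq_bigr => x _; rewrite !mulr_sumr -big_split /= -sumrB.
by apply: eq_bigr => y _; rewrite exprMn !exprS; ring.
Qed.

Let power_sum_step a : M a ^+ a.+1 <= M 0 * M a.+1 ^+ a.
Proof.
elim: a => [|a IH]; first by rewrite expr1 expr0 mulr1.
have [M0|Mn0] := eqVneq (M a.+1) 0.
  by rewrite M0 expr0n /= mulr_ge0 ?exprn_ge0.
have Mp : 0 < M a.+1 by rewrite lt_def Mn0 M_ge0.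
rewrite -(ler_pM2r (exprn_gt0 a Mp)).
have -> : M a.+1 ^+ a.+2 * M a.+1 ^+ a = (M a.+1 ^+ 2) ^+ a.+1.
  by rewrite -exprD -exprM; congr (_ ^+ _); rewrite mulnC muln2 -addnn !addSn !addnS.
apply: (le_trans (lerXn2r a.+1 _ _ (power_sum_log_convex a))).
- by rewrite nnegrE exprn_ge0.
- by rewrite nnegrE mulr_ge0.
rewrite exprMn [leRHS]mulrAC ler_wpM2r ?exprn_ge0//.
Qed.

(** Iterating log-convexity bounds [M a ^ (a + 1)] by [M 0 * M (a + 1) ^ a];
chaining these bounds from [a] up to [c] gives the power mean inequality. *)
Lemma power_mean_le a c : (a <= c)%N ->
  M a ^+ c <= #|A|%:R ^+ (c - a) * M c ^+ a.
Proof.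
have -> : #|A|%:R = M 0.
  by rewrite /M -sum1_card natr_sum; apply: eq_bigr => x _; rewrite expr0.
move=> /subnKC; move: (c - a)%N => e <- {c}.
elim: e => [|e IH]; first by rewrite addn0 expr0 mul1r.
have [/eqP|c0] := posnP (a + e).
  rewrite addn_eq0 => /andP[/eqP -> /eqP ->].
  by rewrite expr0 mulr1.
rewrite -(ler_pXn2r c0) ?nnegrE ?mulr_ge0 ?exprn_ge0 ?M_ge0//.
rewrite -exprM mulnC exprM.
rewrite (le_trans (lerXn2r _ _ _ IH)) ?nnegrE ?mulr_ge0 ?exprn_ge0 ?M_ge0//.
rewrite !exprMn.
have -> : (M (a + e) ^+ a) ^+ (a + e.+1) = (M (a + e) ^+ (a + e).+1) ^+ a.
  by rewrite -!exprM mulnC addnS.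
rewrite (le_trans (ler_wpM2l _ (lerXn2r _ _ _ (power_sum_step (a + e)))))
  ?nnegrE ?mulr_ge0 ?exprn_ge0 ?M_ge0//.
rewrite exprMn mulrA -!exprM -exprD addnS.
have -> : (e * (a + e).+1 + a = e.+1 * (a + e))%N by lia.
by rewrite [((a + e) * a)%N]mulnC.
Qed.

End PowerSums.

(** * Second moments over a 2-design *)

(** In the notation of design theory the parameters are [k = K], [r = N1] and
[lambda = N2]; they are independent arguments because the planes supply
[N1] and [N2] only through an existence statement. *)
Definition two_design (T : finType) (B : {set {set T}}) (K N1 N2 : nat) :=
  [/\ forall w, w \in B -> #|w| = K,
      forall x, #|[set w in B | x \in w]| = N1 &
      forall x y, x != y -> #|[set w in B | (x \in w) && (y \in w)]| = N2].

Section TwoDesigns.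
Set Implicit Arguments.
Unset Strict Implicit.
Variables (R : realFieldType) (T : finType) (B : {set {set T}}).
Variables (K N1 N2 : nat).
Hypothesis desB : two_design B K N1 N2.

Lemma two_design_sum (g : T -> R) :
  \sum_(w in B) \sum_(x in w) g x = N1%:R * \sum_x g x.
Proof.
have [_ H1 _] := desB.
rewrite (exchange_big_dep xpredT)//= mulr_sumr; apply: eq_bigr => x _.
by rewrite -(H1 x) sumr_const mulr_natl -cardsE; congr (_ *+ #|pred_of_set _|).
Qed.

(** Expanding the square counts an ordered pair of points once for each block
containing both: [N1] times on the diagonal and [N2] times off it. *)
Lemma two_design_sqr_sum (g : T -> R) :
  \sum_(w in B) (\sum_(x in w) g x) ^+ 2 =
  N2%:R * ((\sum_x g x) ^+ 2 - \sum_x g x ^+ 2) + N1%:R * \sum_x g x ^+ 2.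
Proof.
have [_ H1 H2] := desB.
have -> : \sum_(w in B) (\sum_(x in w) g x) ^+ 2 =
   \sum_x \sum_y #|[set w in B | (x \in w) && (y \in w)]|%:R * (g x * g y).
  under eq_bigr => w _ do rewrite expr2 mulr_suml.
  rewrite (exchange_big_dep xpredT)//=; apply: eq_bigr => x _.
  under eq_bigr => w _ do rewrite mulr_sumr.
  rewrite (exchange_big_dep xpredT)//=; apply: eq_bigr => y _.
  rewrite sumr_const mulr_natl -cardsE; congr (_ *+ #|pred_of_set _|).
  by apply/setP => w; rewrite !inE andbA.
have E x y : #|[set w in B | (x \in w) && (y \in w)]|%:R * (g x * g y)
   = N2%:R * (g x * g y) + (N1%:R - N2%:R) * ((x == y)%:R * (g x * g y)).
  have [->|xy] := eqVneq x y; last by rewrite H2// mulr0n; ring.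
  under eq_finset => w do rewrite andbb.
  by rewrite H1 mulr1n; ring.
under eq_bigr => x _ do (under eq_bigr => y _ do rewrite E).
under eq_bigr => x _ do rewrite big_split /= -!mulr_sumr.
rewrite big_split /= -!mulr_sumr.
have -> : \sum_x \sum_y (x == y)%:R * (g x * g y) = \sum_x g x ^+ 2.
  apply: eq_bigr => x _; rewrite (bigD1 x)//= eqxx mul1r big1 ?addr0 ?expr2//.
  by move=> y; rewrite eq_sym => /negbTE ->; rewrite mul0r.
by rewrite -mulr_suml; ring.
Qed.

Lemma two_design_card : #|B|%:R * K%:R = N1%:R * #|T|%:R :> R.
Proof.
have [HK _ _] := desB.
have := two_design_sum (fun=> 1); rewrite sumr_const cardT -cardE => <-.
by rewrite (eq_bigr (fun=> K%:R)) => [|w /HK <-]; rewrite ?sumr_const// mulr_natl.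
Qed.

(** Both sides count the pairs [(y, w)] with [y != x] and [x], [y] in [w]. *)
Lemma two_design_pair_card (x : T) : (N2 * #|T|.-1 = N1 * K.-1)%N.
Proof.
have [HK H1 H2] := desB.
rewrite -(cardsC1 x) mulnC -sum_nat_const.
rewrite (eq_bigr (fun y => \sum_(w in [set w in B | (x \in w) && (y \in w)]) 1)%N);
  last by move=> y; rewrite !inE eq_sym => /(H2 x y) <-; rewrite sum1_card.
rewrite (exchange_big_dep [pred w in B | x \in w])/=; last first.
  by move=> y w _; rewrite !inE => /andP[-> /andP[-> _]].
rewrite -[in RHS](H1 x) -sum_nat_const.
apply: eq_big => [w|w]; first by rewrite !inE.
move=> /andP[wB xw]; rewrite -(HK w wB) (cardsD1 x w) xw /= -sum1_card.
by apply: eq_bigl => y; rewrite !inE wB xw.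
Qed.

Hypothesis T_gt1 : (1 < #|T|)%N.

(** Negative correlation: given that a block contains [x], a second point lies
on it with probability [(K - 1) / (#|T| - 1) <= K / #|T|]. *)
Lemma two_design_pair_le : #|T|%:R * N2%:R <= K%:R * N1%:R :> R.
Proof.
have [HK H1 H2] := desB.
have /card_gt0P[x _] : (0 < #|T|)%N by lia.
have E := two_design_pair_card x.
rewrite -!natrM ler_nat -(leq_pmul2r (_ : 0 < #|T|.-1)%N); last by lia.
have [N10|N1gt0] := posnP N1; first by nia.
have : (0 < #|[set w in B | x \in w]|)%N by rewrite H1.
case/card_gt0P => w; rewrite inE => /andP[/HK wK xw].
have Kgt0 : (0 < K)%N by rewrite -wK; apply/card_gt0P; exists x.
have KT : (K <= #|T|)%N by rewrite -wK max_card.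
have H : (#|T| * K.-1 <= K * #|T|.-1)%N.
  by rewrite -!subn1 !mulnBr !muln1 mulnC leq_sub2l.
by rewrite -mulnA E mulnCA [(K * N1)%N]mulnC -mulnA leq_mul2l H orbT.
Qed.

(** Expanding the square, the coefficient of the squared total of [g] is
[N2 - N1 * K / #|T| <= 0] by negative correlation, and only the diagonal
contribution is left. *)
Lemma two_design_variance_le (g : T -> R) :
  \sum_(w in B) (\sum_(x in w) g x - K%:R / #|T|%:R * \sum_x g x) ^+ 2
    <= N1%:R * \sum_x g x ^+ 2.
Proof.
set m := K%:R / #|T|%:R; set G := \sum_x g x.
have Tn0 : #|T|%:R != 0 :> R by rewrite pnatr_eq0; lia.
have -> : \sum_(w in B) (\sum_(x in w) g x - m * G) ^+ 2 =
    \sum_(w in B) (\sum_(x in w) g x) ^+ 2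
    - 2 * (m * G) * (\sum_(w in B) \sum_(x in w) g x)
    + #|B|%:R * (m * G) ^+ 2.
  rewrite [#|B|%:R * _]mulr_natl -sumr_const [X in _ - X + _]mulr_sumr.
  rewrite -sumrB -big_split /=.
  by apply: eq_bigr => w _; ring.
rewrite two_design_sqr_sum two_design_sum -/G.
have BE : #|B|%:R * m = N1%:R by rewrite mulrA two_design_card mulfK.
have N2le : N2%:R <= m * N1%:R.
  by rewrite /m mulrAC ler_pdivlMr ?ltr0n ?(ltnW T_gt1)// mulrC two_design_pair_le.
have -> : #|B|%:R * (m * G) ^+ 2 = N1%:R * m * G ^+ 2 by rewrite -BE; ring.
rewrite -subr_ge0.
have -> : N1%:R * (\sum_x g x ^+ 2) - (N2%:R * (G ^+ 2 - \sum_x g x ^+ 2) +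
   N1%:R * (\sum_x g x ^+ 2) - 2 * (m * G) * (N1%:R * G) + N1%:R * m * G ^+ 2)
  = N2%:R * (\sum_x g x ^+ 2) + (m * N1%:R - N2%:R) * G ^+ 2 by ring.
apply: addr_ge0; apply: mulr_ge0; rewrite ?subr_ge0 ?sqr_ge0 ?ler0n//.
by apply: sumr_ge0 => x _; rewrite sqr_ge0.
Qed.

End TwoDesigns.

(** * The X-ray transform *)

Section Xray.
Set Implicit Arguments.
Unset Strict Implicit.
Variables (R : realFieldType) (T : finType) (h : T -> R) (d : nat).
Hypotheses (h_ge0 : forall x, 0 <= h x) (d_gt0 : (0 < d)%N).

(** Let [x0] maximise [h] on [A] and let [S] be the sum of [h ^ 2] over the rest
of [A]. If [h x0 ^ 2] exceeds [S], the diagonal term of [x0] suffices. If not,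
the power mean inequality bounds [S ^ (d + 1)] by the square of the sum of
[h ^ (d + 1)] over the rest; the diagonal part of this square is bounded by
its products with [h x0 ^ (d + 1)], which are off-diagonal in [A]. *)
Lemma sqr_sum_diag_offdiag (A : {set T}) :
  (\sum_(x in A) h x ^+ 2) ^+ d.+1 <=
  2 ^+ d.+1 * (\sum_(x in A) (h x ^+ d.+1) ^+ 2
    + #|A|%:R ^+ d.-1 * ((\sum_(x in A) h x ^+ d.+1) ^+ 2
                         - \sum_(x in A) (h x ^+ d.+1) ^+ 2)).
Proof.
have [->|[x1 x1A]] := set_0Vmem A.
  by rewrite !big_set0 !expr0n /= subrr mulr0 addr0 mulr0.
case: (arg_maxP h x1A) => x0 x0A /= hmax.
pose b x := h x ^+ d.+1.
have b_ge0 x : 0 <= b x by rewrite exprn_ge0.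
pose A' := A :\ x0.
have split_sum (g : T -> R) : \sum_(x in A) g x = g x0 + \sum_(x in A') g x.
  by rewrite (bigD1 x0)//=; congr (_ + _); apply: eq_bigl => x; rewrite !inE andbC.
rewrite !split_sum -/(b x0).
set S := \sum_(x in A') h x ^+ 2; set V := \sum_(x in A') b x.
set Q := \sum_(x in A') b x ^+ 2.
have V_ge0 : 0 <= V by apply: sumr_ge0.
have S_ge0 : 0 <= S by apply: sumr_ge0 => x _; rewrite exprn_ge0.
have Q_ge0 : 0 <= Q by apply: sumr_ge0 => x _; rewrite exprn_ge0.
have QV : Q <= b x0 * V.
  rewrite mulr_sumr; apply: ler_sum => x; rewrite inE => /andP[_ xA].
  by rewrite expr2 ler_wpM2r// lerXn2r ?nnegrE// hmax.
have VV : V ^+ 2 <= (b x0 + V) ^+ 2 - (b x0 ^+ 2 + Q).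
  by have := b_ge0 x0; nra.
have pm : S ^+ d.+1 <= #|A|%:R ^+ d.-1 * V ^+ 2.
  apply: (le_trans (power_mean_le A' h_ge0 (_ : 2 <= d.+1)%N)) => //.
  have -> : (d.+1 - 2 = d.-1)%N by lia.
  rewrite ler_wpM2r ?sqr_ge0// lerXn2r ?nnegrE ?ler0n// ler_nat.
  by rewrite subset_leq_card// subD1set.
have two_max : (h x0 ^+ 2 + S) ^+ d.+1 <= 2 ^+ d.+1 * (b x0 ^+ 2 + S ^+ d.+1).
  have -> : b x0 ^+ 2 = (h x0 ^+ 2) ^+ d.+1 by rewrite -!exprM mulnC.
  have hx0 : 0 <= h x0 ^+ 2 by rewrite exprn_ge0.
  have [le|/ltW le] := leP S (h x0 ^+ 2).
    apply: (@le_trans _ _ ((2 * h x0 ^+ 2) ^+ d.+1)).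
      by rewrite lerXn2r ?nnegrE ?addr_ge0 ?mulr_ge0//; lra.
    by rewrite exprMn ler_wpM2l ?exprn_ge0// lerDl exprn_ge0.
  apply: (@le_trans _ _ ((2 * S) ^+ d.+1)).
    by rewrite lerXn2r ?nnegrE ?addr_ge0 ?mulr_ge0//; lra.
  by rewrite exprMn ler_wpM2l ?exprn_ge0// lerDr exprn_ge0.
apply: (le_trans two_max); rewrite ler_wpM2l ?exprn_ge0//.
apply: lerD; first by rewrite lerDl.
by apply: (le_trans pm); rewrite ler_wpM2l ?exprn_ge0 ?ler0n.
Qed.

Variables (B : {set {set T}}) (K N1 N2 : nat).
Hypothesis desB : two_design B K N1 N2.
Hypothesis T_gt1 : (1 < #|T|)%N.

(** For lines in a [d]-dimensional space [K ^ d = #|T|], and then the factor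
[K ^ (d - 1)] of the off-diagonal part is absorbed by
[N2 <= N1 * K / #|T|]. *)
Lemma two_design_xray : (K ^ d <= #|T|)%N ->
  \sum_(w in B) (\sum_(x in w) h x ^+ 2) ^+ d.+1 <=
  2 ^+ d.+2 * (N1%:R * (\sum_x h x ^+ d.+1) ^+ 2).
Proof.
move=> KT; have [HK _ _] := desB.
pose b x := h x ^+ d.+1.
have b_ge0 x : 0 <= b x by rewrite exprn_ge0.
set S := \sum_x h x ^+ d.+1.
have QS : \sum_x b x ^+ 2 <= S ^+ 2.
  rewrite expr2 mulr_sumr; apply: ler_sum => x _.
  rewrite expr2 ler_wpM2r// /S (bigD1 x)//= lerDl.
  by apply: sumr_ge0 => y _; exact: b_ge0.
have Q_ge0 : 0 <= \sum_x b x ^+ 2 by apply: sumr_ge0 => x _; rewrite exprn_ge0.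
have N2le : K%:R ^+ d.-1 * N2%:R <= N1%:R :> R.
  rewrite -(ler_pM2l (_ : 0 < #|T|%:R)) ?ltr0n ?(ltnW T_gt1)//.
  apply: (@le_trans _ _ (K%:R ^+ d * N1%:R)); last first.
    by rewrite ler_wpM2r ?ler0n// -natrX ler_nat.
  rewrite mulrCA -{2}(prednK d_gt0) exprSr -mulrA ler_wpM2l ?exprn_ge0 ?ler0n//.
  exact: two_design_pair_le desB T_gt1.
apply: (@le_trans _ _ (\sum_(w in B) 2 ^+ d.+1 * (\sum_(x in w) b x ^+ 2
    + K%:R ^+ d.-1 * ((\sum_(x in w) b x) ^+ 2 - \sum_(x in w) b x ^+ 2)))).
  by apply: ler_sum => w wB; rewrite -(HK w wB) sqr_sum_diag_offdiag.
rewrite -mulr_sumr (exprSr 2 d.+1) -mulrA ler_wpM2l ?exprn_ge0//.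
rewrite big_split /= -mulr_sumr sumrB (two_design_sqr_sum desB).
rewrite (two_design_sum desB) -/S.
set Q := \sum_x b x ^+ 2 in QS Q_ge0 *.
rewrite addrK mulrA.
have := ler0n R N1; have := sqr_ge0 S.
have H : K%:R ^+ d.-1 * N2%:R * (S ^+ 2 - Q) <= N1%:R * (S ^+ 2 - Q).
  by rewrite ler_wpM2r// subr_ge0.
by move: H QS Q_ge0; nra.
Qed.

End Xray.

(** * The Radon transform *)

Section DyadicLevels.
Set Implicit Arguments.
Unset Strict Implicit.
Variables (R : realType).

(** The bound on [i] is what later allows finitely many levels to serve all the
planes at once. *)
Lemma dyadic_level (M l : R) : 0 < l -> l <= M ->
  exists2 i, (i <= Num.truncn (M / l))%N & M / 2 ^+ i.+1 < l <= M / 2 ^+ i.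
Proof.
move=> l_gt0 lM.
have P0 : M / 2 ^+ (Num.truncn (M / l)).+1 < l.
  rewrite ltr_pdivrMr ?exprn_gt0// mulrC -ltr_pdivrMr//.
  apply: (lt_le_trans (truncnS_gt _)).
  by rewrite -natrX ler_nat ltnW// ltn_expl.
have ex : exists i, M / 2 ^+ i.+1 < l by exists (Num.truncn (M / l)).
case: (ex_minnP ex) => i Pi imin; exists i; first exact: imin.
rewrite Pi /=; case: i Pi imin => [|i] _ imin; first by rewrite expr0 divr1.
by rewrite leNgt; apply/negP => /imin; rewrite ltnn.
Qed.

(** The positivity of [e] makes the ratio [2 ^ (- e)] at most one half. *)
Lemma dyadic_geometric_sum (M : R) e L : (0 < e)%N -> 0 <= M ->
  \sum_(i < L) (M / 2 ^+ i) ^+ e <= 2 * M ^+ e.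
Proof.
move=> e_gt0; elim: L M => [|L IH] M M0.
  by rewrite big_ord0 mulr_ge0 ?exprn_ge0.
rewrite big_ord_recl /= expr0 divr1 [leRHS]mulr_natl mulr2n lerD2l.
under eq_bigr => i _ do rewrite /bump /= add1n exprS invfM mulrA.
apply: (le_trans (IH (M / 2) (divr_ge0 M0 _))) => //.
rewrite exprMn mulrCA ler_piMr ?exprn_ge0//.
rewrite -(prednK e_gt0) exprS mulrA divff ?pnatr_eq0// mul1r exprn_ile1 ?invr_ge0//.
by rewrite invf_le1 ?ler1n.
Qed.

(** The terms that remain form a geometric progression whose largest member is
at most [A ^ e]. *)
Lemma dyadic_sum_below (M A : R) e L : (0 < e)%N -> 0 <= M -> 0 <= A ->
  \sum_(i < L | M / 2 ^+ i <= A) (M / 2 ^+ i) ^+ e <= 2 * A ^+ e.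
Proof.
move=> e_gt0; elim: L M => [|L IH] M M0 A0.
  by rewrite big_ord0 mulr_ge0 ?exprn_ge0.
have [MA|AM] := leP M A.
  apply: (@le_trans _ _ (2 * M ^+ e)); last first.
    by rewrite ler_wpM2l// lerXn2r ?nnegrE.
  apply: le_trans (dyadic_geometric_sum L.+1 e_gt0 M0).
  rewrite [leRHS](bigID (fun i : 'I_L.+1 => M / 2 ^+ i <= A))/= lerDl.
  by apply: sumr_ge0 => i _; rewrite exprn_ge0// divr_ge0// exprn_ge0.
rewrite big_mkcond big_ord_recl /= expr0 divr1 (lt_geF AM) add0r -big_mkcond.
rewrite (eq_bigl (fun i : 'I_L => M / 2 / 2 ^+ i <= A)) => [|i]; last first.
  by rewrite /bump /= add1n exprS invfM mulrA.
under eq_bigr => i _ do rewrite /bump /= add1n exprS invfM mulrA.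
exact: (IH (M / 2) (divr_ge0 M0 _)).
Qed.

End DyadicLevels.

Section Radon.
Set Implicit Arguments.
Unset Strict Implicit.
Variables (R : realType) (T : finType) (h : T -> R) (e : nat).
Hypotheses (h_ge0 : forall x, 0 <= h x) (e_gt0 : (0 < e)%N).
Variables (B : {set {set T}}) (K N1 N2 : nat).
Hypothesis desB : two_design B K N1 N2.
Hypothesis T_gt1 : (1 < #|T|)%N.

Let f x := h x ^+ e.+1.
Let S := \sum_x h x ^+ e.+2.
Let m := K%:R / #|T|%:R * \sum_x f x.

(* The cut-off is tuned to the tail: each value removed at level mu satisfies
   8 * S * f x < mu * h x ^ (e + 2), and the right-hand sides add up to at most
   mu * S. *)
Let trunc mu x := if h x * mu <= 8 * S then f x else 0.

Let f_ge0 x : 0 <= f x.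
Proof. by rewrite exprn_ge0. Qed.

Let S_ge0 : 0 <= S.
Proof. by apply: sumr_ge0 => x _; rewrite exprn_ge0. Qed.

Let m_ge0 : 0 <= m.
Proof. by apply: mulr_ge0; [exact: divr_ge0|exact: sumr_ge0]. Qed.

Let trunc_le mu x : 0 <= trunc mu x <= f x.
Proof. by rewrite /trunc; case: ifP => _; rewrite ?lexx f_ge0. Qed.

Lemma truncation_tail mu : 0 < S -> 0 <= mu ->
  \sum_x (f x - trunc mu x) <= mu / 8.
Proof.
move=> S_gt0 mu_ge0.
rewrite -(ler_pM2l (_ : 0 < 8 * S)) ?mulr_gt0//.
have -> : 8 * S * (mu / 8) = \sum_x h x ^+ e.+2 * mu.
  by rewrite -mulr_suml -/S; field.
rewrite mulr_sumr; apply: ler_sum => x _; rewrite /trunc.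
case: (leP (h x * mu)) => [_|lt]; first by rewrite subrr mulr0 mulr_ge0// exprn_ge0.
by rewrite subr0 exprS [leRHS]mulrAC ler_wpM2r// ltW.
Qed.

(** Of the plane sum [l], truncation loses at most [mu / 8 <= l / 4], and the
average of the truncated function is at most [m <= l / 4]; so the deviation
from the average is at least [l / 2]. This turns the large power of [l] into a
square, which the variance bound controls, times [mu ^ e]. *)
Lemma large_plane_sum_le (w : {set T}) mu : let l := \sum_(x in w) f x in
  4 * m < l -> mu / 2 < l <= mu ->
  l ^+ e.+2 <= 4 * mu ^+ e *
    (\sum_(x in w) trunc mu x - K%:R / #|T|%:R * \sum_x trunc mu x) ^+ 2.
Proof.
move=> l ml /andP[mul lmu].
have l_gt0 : 0 < l by apply: le_lt_trans ml; rewrite mulr_ge0.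
have mu_gt0 : 0 < mu by apply: lt_le_trans lmu.
have S_gt0 : 0 < S.
  rewrite lt_def S_ge0 andbT; apply/eqP => S0.
  have h0 x : h x = 0.
    have /eqP := S0; rewrite psumr_eq0 => [|y _]; last by rewrite exprn_ge0.
    by move=> /allP/(_ x (mem_index_enum x))/=; rewrite expf_eq0 /= => /eqP.
  by move: l_gt0; rewrite /l big1 ?ltxx// => x _; rewrite /f h0 expr0n.
have tail := truncation_tail S_gt0 (ltW mu_gt0).
set u := \sum_(x in w) trunc mu x; set v := _ * \sum_x _.
have lu : l - u <= mu / 8.
  apply: le_trans tail; rewrite -sumrB [leRHS](bigID (mem w))/= lerDl.
  by apply: sumr_ge0 => x _; rewrite subr_ge0; case/andP: (trunc_le mu x).
have vm : v <= m.
  rewrite ler_wpM2l ?divr_ge0//; apply: ler_sum => x _.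
  by case/andP: (trunc_le mu x).
rewrite -addn2 exprD.
have -> : 4 * mu ^+ e * (u - v) ^+ 2 = mu ^+ e * (2 * (u - v)) ^+ 2 by ring.
apply: ler_pM; rewrite ?exprn_ge0 ?(ltW l_gt0)//.
  by rewrite lerXn2r ?nnegrE ?(ltW l_gt0) ?(ltW mu_gt0).
have luv : l <= 2 * (u - v) by lra.
by rewrite lerXn2r ?nnegrE ?(ltW l_gt0)//; lra.
Qed.

(** After exchanging the sums, a point [x] contributes only at the levels with
[h x * mu <= 8 * S], that is, a geometric series bounded by its largest term.
The powers of [h x] then add up to exactly [h x ^ (e + 2)]: this is why the
exponents of the endpoint estimate are attained without a logarithmic loss. *)
Lemma truncation_levels_le (M : R) L : 0 <= M ->
  \sum_(i < L) (M / 2 ^+ i) ^+ e * (\sum_x trunc (M / 2 ^+ i) x ^+ 2)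
   <= 2 * 8 ^+ e * S ^+ e.+1.
Proof.
move=> M0.
under eq_bigr => i _ do rewrite mulr_sumr.
rewrite exchange_big /=.
have -> : 2 * 8 ^+ e * S ^+ e.+1 = \sum_x h x ^+ e.+2 * (2 * (8 * S) ^+ e).
  by rewrite -mulr_suml -/S exprMn exprS; ring.
apply: ler_sum => x _.
apply: (@le_trans _ _ (h x ^+ e.+2 *
   \sum_(i < L | h x * M / 2 ^+ i <= 8 * S) (h x * M / 2 ^+ i) ^+ e)); last first.
  by rewrite ler_wpM2l ?exprn_ge0// dyadic_sum_below ?mulr_ge0.
rewrite mulr_sumr [leRHS]big_mkcond; apply: ler_sum => i _.
rewrite /trunc -mulrA; case: ifP => _; last by rewrite expr0n /= mulr0.
by rewrite /f [in leRHS]exprMn -exprM muln2 -addnn addSnnS exprD; lra.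
Qed.

(** For hyperplanes in dimension [d = e + 1] the hypothesis is an equality. It
is used for the planes whose sum is comparable to the average, where it makes
the constant functions satisfy the estimate. *)
Lemma two_design_radon : (K ^ e.+1 <= #|T| ^ e)%N ->
  \sum_(w in B) (\sum_(x in w) h x ^+ e.+1) ^+ e.+2 <=
  (4 ^+ e.+2 + 8 ^+ e.+1) * (N1%:R * S ^+ e.+1).
Proof.
move=> KT.
have T_gt0 : 0 < #|T|%:R :> R by rewrite ltr0n ltnW.
pose l (w : {set T}) := \sum_(x in w) f x.
pose M := \sum_x f x.
have M_ge0 : 0 <= M by exact: sumr_ge0.
have lM w : l w <= M.
  by rewrite /M [leRHS](bigID (mem w))/= lerDl; exact: sumr_ge0.
pose L := (\max_(w in B) Num.truncn (M / l w)).+1.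
pose mu (i : nat) := M / 2 ^+ i.
pose osc (w : {set T}) i := 4 * mu i ^+ e *
    (\sum_(x in w) trunc (mu i) x - K%:R / #|T|%:R * \sum_x trunc (mu i) x) ^+ 2.
have mu_ge0 i : 0 <= mu i by rewrite divr_ge0// exprn_ge0.
have osc_ge0 w i : 0 <= osc w i.
  by rewrite mulr_ge0 ?sqr_ge0// mulr_ge0 ?exprn_ge0.
have pointwise w : w \in B ->
    l w ^+ e.+2 <= (4 * m) ^+ e.+2 + \sum_(i < L) osc w i.
  move=> wB.
  have osc_sum_ge0 : 0 <= \sum_(i < L) osc w i by apply: sumr_ge0.
  have [le|gt] := leP (l w) (4 * m).
    apply: (@le_trans _ _ ((4 * m) ^+ e.+2)); last by rewrite lerDl.
    have l_ge0 : 0 <= l w by exact: sumr_ge0.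
    rewrite lerXn2r ?nnegrE//; by rewrite mulr_ge0.
  have lw_gt0 : 0 < l w.
    by apply: le_lt_trans gt; rewrite mulr_ge0.
  have [i iL /andP[i1 i2]] := dyadic_level lw_gt0 (lM w).
  have iL' : (i < L)%N.
    by rewrite ltnS (leq_trans iL)//; exact: leq_bigmax_cond.
  have : l w ^+ e.+2 <= osc w i.
    apply: large_plane_sum_le => //; rewrite i2 andbT.
    by move: i1; rewrite exprSr invfM mulrA.
  move=> /le_trans; apply.
  rewrite (bigD1 (Ordinal iL'))//= addrCA lerDl; apply: addr_ge0; last exact: sumr_ge0.
  by apply: exprn_ge0; rewrite mulr_ge0.
apply: (le_trans (ler_sum _ pointwise)).
rewrite big_split /= [leRHS]mulrDl; apply: lerD.
- rewrite sumr_const -[leLHS]mulr_natl [(4 * m) ^+ _]exprMn mulrCA ler_wpM2l ?exprn_ge0//.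
  have BK : #|B|%:R * (K%:R / #|T|%:R) = N1%:R :> R.
    by rewrite mulrA (two_design_card R desB) mulfK// gt_eqF.
  have ratio : (K%:R / #|T|%:R) ^+ e.+1 * #|T|%:R <= 1 :> R.
    rewrite expr_div_n -mulrA [X in _ * (X^-1 * _)]exprSr invfM mulfVK ?gt_eqF//.
    by rewrite ler_pdivrMr ?exprn_gt0// mul1r -!natrX ler_nat.
  have pm : M ^+ e.+2 <= #|T|%:R * S ^+ e.+1.
    have setTE (g : T -> R) : \sum_(x in [set: T]) g x = \sum_x g x.
      by apply: eq_bigl => x; rewrite inE.
    have := power_mean_le [set: T] h_ge0 (leqnSn e.+1).
    by rewrite subSnn expr1 cardsT !setTE.
  rewrite /m -/M; move: BK ratio.
  have : 0 <= K%:R / #|T|%:R :> R by rewrite divr_ge0.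
  move: (K%:R / #|T|%:R) => r r_ge0 BK ratio.
  rewrite exprMn exprS -mulrA [leLHS]mulrA BK ler_wpM2l//.
  apply: le_trans (ler_wpM2l _ pm) _; first by rewrite exprn_ge0.
  by rewrite mulrA ler_piMl ?exprn_ge0.
rewrite exchange_big /=.
apply: (@le_trans _ _
  (\sum_(i < L) 4 * N1%:R * (mu i ^+ e * \sum_x trunc (mu i) x ^+ 2))).
  apply: ler_sum => i _; rewrite -mulr_sumr.
  have -> (a b c : R) : 4 * a * (b * c) = 4 * b * (a * c) by ring.
  rewrite -[leLHS]mulrA -[leRHS]mulrA ler_wpM2l// ler_wpM2l ?exprn_ge0//.
  exact: two_design_variance_le desB T_gt1 _.
rewrite -mulr_sumr.
apply: le_trans (ler_wpM2l _ (truncation_levels_le L M_ge0)) _.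
  by rewrite mulr_ge0.
by rewrite [8 ^+ e.+1]exprS; lra.
Qed.

End Radon.

(** * Affine planes over a finite field form a 2-design *)

Section PlanesDesign.
Set Implicit Arguments.
Unset Strict Implicit.
Variables (F : finFieldType) (d k : nat).
Local Notation V := 'rV[F]_d.
Local Notation q := #|F|.

Lemma card_kplane (w : {set V}) : w \in kplanes F d k -> #|w| = (q ^ k)%N.
Proof.
rewrite inE => /asboolP[v [U [<- ->]]].
rewrite -card_vspace -(card_imset (mem U) (addIr v)).
apply: eq_card => x; rewrite inE; apply/idP/imsetP => [xU|[y yU ->]].
  by exists (x - v); rewrite ?subrK.
by rewrite addrK.
Qed.

Lemma kplanes_affine_image (M : 'M[F]_d) (c : V) w : M \in unitmx ->
  w \in kplanes F d k -> [set x *m M + c | x in w] \in kplanes F d k.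
Proof.
move=> Mu; rewrite !inE => /asboolP[v [U [dimU ->]]]; apply/asboolP.
pose g : 'End(V) := linfun (mulmxr M).
exists (v *m M + c), (g @: U)%VS; split.
  rewrite limg_dim_eq//; apply/eqP; rewrite -subv0; apply/subvP => x.
  rewrite memv_cap memv_ker lfunE /= => /andP[_ /eqP xM].
  by rewrite -(mulmxK Mu x) xM mul0mx mem0v.
apply/setP => y; rewrite inE; apply/imsetP/memv_imgP => [[x xU ->]|[u uU yE]].
  exists (x - v); first by move: xU; rewrite inE.
  by rewrite lfunE /= mulmxBl opprD addrACA subrr addr0.
exists (u + v); first by rewrite inE addrK.
by move: yE; rewrite lfunE /= mulmxDl => <-; rewrite -addrA subrK.
Qed.

(** An affine bijection sends distinct planes containing [P] to distinct planes
containing the image of [P]; applied in both directions, this shows that the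
number of planes containing a set is invariant. *)
Lemma kplanes_incidence_le (P : {set V}) (M : 'M[F]_d) (c : V) : M \in unitmx ->
  (#|[set w in kplanes F d k | P \subset w]|
   <= #|[set w in kplanes F d k | [set (x *m M + c)%R | x in P] \subset w]|)%N.
Proof.
move=> Mu.
have ginj : injective (fun x : V => x *m M + c).
  by move=> x y /addIr/(can_inj (mulmxK Mu)).
rewrite -(card_imset _ (imset_inj ginj)); apply/subset_leq_card/subsetP => w'.
case/imsetP => w; rewrite inE => /andP[wk Pw] ->; rewrite inE.
apply/andP; split; last exact: imsetS.
exact: kplanes_affine_image.
Qed.

Lemma nonzero_transitive (u v : V) : u != 0 -> v != 0 ->
  exists2 M : 'M[F]_d, M \in unitmx & u *m M = v.
Proof.
move=> u0 v0.
have uE : u *m (pinvmx u *m v) = v.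
  by rewrite mulmxA mulmxVp ?mul1mx// /row_free rank_rV u0.
have [|M Mu ME] := complete_unitmx (U := u) (f := pinvmx u *m v).
  by rewrite uE !rank_rV u0 v0.
by exists M => //; rewrite -ME.
Qed.

(** Translations are transitive on points, and affine bijections are transitive
on pairs of distinct points. *)
Lemma kplanes_two_design : exists N1 N2,
  two_design (kplanes F d k) (q ^ k)%N N1 N2.
Proof.
pose N (P : {set V}) := #|[set w in kplanes F d k | P \subset w]|.
have N1le x y : (N [set x] <= N [set y])%N.
  have := kplanes_incidence_le [set x] (y - x) (unitmx1 F d).
  by rewrite imset_set1 mulmx1 addrC subrK.
have N2le x y x' y' : x != y -> x' != y' -> (N [set x; y] <= N [set x'; y'])%N.
  rewrite -subr_eq0 => xy; rewrite -subr_eq0 => xy'.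
  have [M Mu ME] := nonzero_transitive xy xy'.
  have := kplanes_incidence_le [set x; y] (x' - x *m M) Mu.
  rewrite imsetU !imset_set1 addrC subrK.
  suff -> : y *m M + (x' - x *m M) = y' by [].
  by rewrite addrCA -mulmxBl -opprB mulNmx ME opprB addrC subrK.
have N1E (x : V) : #|[set w in kplanes F d k | x \in w]| = N [set x].
  by congr #|pred_of_set _|; apply/setP => w; rewrite !inE sub1set.
have N2E (x y : V) :
    #|[set w in kplanes F d k | (x \in w) && (y \in w)]| = N [set x; y].
  by congr #|pred_of_set _|; apply/setP => w; rewrite !inE subUset !sub1set.
exists (N [set 0]).
(* In dimension 0 there are no two distinct points and any second parameter
   will do. *)
have [[v v0]|no] := pselect (exists v : V, 0 != v).
  exists (N [set 0; v]); split=> [w||x y xy]; first exact: card_kplane.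
    by move=> x; rewrite N1E; apply/eqP; rewrite eqn_leq !N1le.
  by rewrite N2E; apply/eqP; rewrite eqn_leq !N2le.
exists 0%N; split=> [w||x y xy]; first exact: card_kplane.
  by move=> x; rewrite N1E; apply/eqP; rewrite eqn_leq !N1le.
by case: no; exists (x - y); rewrite eq_sym subr_eq0.
Qed.

End PlanesDesign.

(** * From power sums to norms *)

Section Norms.
Set Implicit Arguments.
Unset Strict Implicit.
Variables (R : realType).

Lemma normc_sum_le (I : finType) (P : pred I) (g : I -> R[i]) :
  Normc.normc (\sum_(x | P x) g x) <= \sum_(x | P x) Normc.normc (g x).
Proof.
elim/big_ind2: _ => [|a b c e ab ce|//]; first by rewrite Normc.normc0.
by apply: le_trans (le_normcD _ _) _; rewrite lerD.
Qed.

Lemma normc_ge0 (z : R[i]) : 0 <= Normc.normc z.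
Proof. by case: z => a b; rewrite sqrtr_ge0. Qed.

Lemma normc_natV (n : nat) : Normc.normc (n%:R^-1 : R[i]) = n%:R^-1.
Proof.
by rewrite Normc.normcV -[n%:R]/(1 *+ n) normcMn Normc.normc1.
Qed.

(** The normalising factors of the two norms cancel exactly: with
[N1 / N = K / n] and [K ^ d = n ^ k] one has
[N1 / (N * K ^ (d + 1)) = 1 / n ^ (k + 1)]. *)
Lemma plane_transform_norm_le (F : finFieldType) d k (f : 'rV[F]_d -> R[i])
    (C0 : R) N1 N2 :
  0 <= C0 -> two_design (kplanes F d k) (#|F| ^ k)%N N1 N2 ->
  (forall h : 'rV[F]_d -> R, (forall x, 0 <= h x) ->
     \sum_(w in kplanes F d k) (\sum_(x in w) h x ^+ k.+1) ^+ d.+1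
       <= C0 * (N1%:R * (\sum_x h x ^+ d.+1) ^+ k.+1)) ->
  avg_Lnorm (kplanes F d k) (d + 1)%:R (plane_transform f)
    <= C0 `^ (d + 1)%:R^-1 * avg_Lnorm [set: 'rV[F]_d] ((d + 1)%:R / (k + 1)%:R) f.
Proof.
move=> C0_ge0 desB power_bound.
set T := 'rV[F]_d in f power_bound *; set B := kplanes F d k in power_bound desB *.
have [HK _ _] := desB.
pose h x := Normc.normc (f x) `^ (k.+1)%:R^-1.
have h_ge0 x : 0 <= h x by exact: powR_ge0.
have hk x : h x ^+ k.+1 = Normc.normc (f x).
  by rewrite -powR_mulrn// -powRrM mulVf ?pnatr_eq0// powRr1 ?normc_ge0.
have hd x : h x ^+ d.+1 = Normc.normc (f x) `^ ((d + 1)%:R / (k + 1)%:R).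
  by rewrite -powR_mulrn// -powRrM mulrC !addn1.
pose K : R := (#|F| ^ k)%:R; pose n : R := #|T|%:R.
have F_gt0 : (0 < #|F|)%N by apply/card_gt0P; exists 0.
have K_gt0 : 0 < K by rewrite ltr0n expn_gt0 F_gt0.
have nE : n = (#|F| ^ d)%:R by rewrite /n card_mx mul1n.
have n_gt0 : 0 < n by rewrite nE ltr0n expn_gt0 F_gt0.
pose S := \sum_x h x ^+ d.+1.
have S_ge0 : 0 <= S by apply: sumr_ge0 => x _; rewrite exprn_ge0.
have KdE : K ^+ d = n ^+ k by rewrite nE /K -!natrX -!expnM mulnC.
have inner : #|B|%:R^-1 * \sum_(w in B) Normc.normc (plane_transform f w) ^+ d.+1
    <= C0 * (n^-1 * S) ^+ k.+1.
  (* For k > d there are no planes and the average over them is 0 / 0 = 0. *)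
  have [B0|B_neq0] := eqVneq #|B| 0%N.
    rewrite B0 invr0 mul0r mulr_ge0// exprn_ge0// mulr_ge0//.
    by rewrite invr_ge0 ltW.
  have B_gt0 : 0 < #|B|%:R :> R by rewrite ltr0n lt0n.
  have NE : N1%:R = #|B|%:R * K / n.
    by rewrite (two_design_card R desB) mulfK// gt_eqF.
  have CE : C0 * (n^-1 * S) ^+ k.+1
      = #|B|%:R^-1 * (K^-1 ^+ d.+1 * (C0 * (N1%:R * S ^+ k.+1))).
    rewrite NE exprMn [n^-1 ^+ _]exprS [n^-1 ^+ _]exprVn -KdE.
    rewrite [K^-1 ^+ _]exprS [K^-1 ^+ _]exprVn.
    move: (K ^+ d) (exprn_gt0 d K_gt0) => Kd Kd_gt0.
    by field; rewrite !gt_eqF.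
  rewrite CE ler_wpM2l ?invr_ge0 ?ler0n//.
  apply: le_trans (ler_wpM2l _ (power_bound h h_ge0)); last first.
    by rewrite exprn_ge0// invr_ge0 ltW.
  rewrite mulr_sumr; apply: ler_sum => w wB; rewrite -exprMn.
  apply: lerXn2r; rewrite ?nnegrE ?normc_ge0//.
    by rewrite mulr_ge0 ?invr_ge0 ?(ltW K_gt0)// sumr_ge0// => x _; rewrite exprn_ge0.
  rewrite /plane_transform Normc.normcM normc_natV (HK w wB) ler_wpM2l ?invr_ge0 ?ler0n//.
  by under [leRHS]eq_bigr => x _ do rewrite hk; exact: normc_sum_le.
rewrite /avg_Lnorm cardsT -/n.
rewrite (eq_bigr (fun w => Normc.normc (plane_transform f w) ^+ d.+1)); last first.
  by move=> w _; rewrite addn1 powR_mulrn ?normc_ge0.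
have -> : \sum_(x in [set: T]) Normc.normc (f x) `^ ((d + 1)%:R / (k + 1)%:R) = S.
  by apply: eq_big => [x|x _]; rewrite ?inE ?hd.
have nS_ge0 : 0 <= n^-1 * S by rewrite mulr_ge0 ?invr_ge0 ?(ltW n_gt0).
have -> : C0 `^ (d + 1)%:R^-1 * (n^-1 * S) `^ ((d + 1)%:R / (k + 1)%:R)^-1
   = (C0 * (n^-1 * S) ^+ k.+1) `^ (d + 1)%:R^-1.
  by rewrite powRM ?exprn_ge0// -powR_mulrn// -powRrM invf_div !addn1.
apply: ge0_ler_powR; rewrite ?nnegrE ?invr_ge0 ?ler0n//.
  by rewrite mulr_ge0 ?invr_ge0// sumr_ge0// => w _; rewrite exprn_ge0 ?normc_ge0.
by rewrite mulr_ge0 ?exprn_ge0.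
Qed.

End Norms.

Theorem theorem1p3 (R : realType) (d k : nat)
    (hd : (2 <= d)%N) (hk : k = 1%N \/ k = (d - 1)%N) :
  exists C : R, forall (F : finFieldType) (f : 'rV[F]_d -> R[i]),
    avg_Lnorm (kplanes F d k) (d + 1)%:R (plane_transform f)
      <= C * avg_Lnorm [set: 'rV[F]_d] ((d + 1)%:R / (k + 1)%:R) f.
Proof.
have d_gt0 : (0 < d)%N by apply: leq_trans hd.
have T_gt1 (F : finFieldType) : (1 < #|{: 'rV[F]_d}|)%N.
  by rewrite card_mx mul1n -(exp1n d) ltn_exp2r// finNzRing_gt1.
have T_pow (F : finFieldType) :
    ((#|F| ^ k) ^ d <= #|{: 'rV[F]_d}| ^ k)%N.
  by rewrite card_mx mul1n -!expnM mulnC.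
case: hk => kE.
- exists ((2 ^+ d.+2) `^ (d + 1)%:R^-1) => F f.
  have [N1 [N2 desB]] := kplanes_two_design F d k.
  apply: (plane_transform_norm_le f _ desB); first by rewrite exprn_ge0.
  move: (T_pow F); rewrite [X in (_ <= _ ^ X)%N]kE expn1 => powle h h_ge0.
  by have := two_design_xray h_ge0 d_gt0 desB (T_gt1 F) powle; rewrite kE.
- exists ((4 ^+ k.+2 + 8 ^+ k.+1) `^ (d + 1)%:R^-1) => F f.
  have [N1 [N2 desB]] := kplanes_two_design F d k.
  apply: (plane_transform_norm_le f _ desB).
    by rewrite addr_ge0 ?exprn_ge0.
  move: desB (T_pow F) (T_gt1 F); have -> : d = k.+1 by lia.
  move=> desB powle T_gt1' h h_ge0.
  apply: two_design_radon desB T_gt1' powle => //; lia.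
Qed.
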